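(* Let $(X,d)$ be a metric space with $|X|\geq 3$ and let $T\colon X\to X$ be a generalized Kannan type mapping on $X$. Then $T$ is continuous at every fixed point of $T$.
   Context: For a metric space $(X,d)$ with $|X|\geq 3$, a mapping $T\colon X\to X$ is called a generalized Kannan type mapping on $X$ if there exists $\lambda\in[0,\frac{2}{3})$ such that the inequality $$d(Tx,Ty)+d(Ty,Tz)+d(Tx,Tz)\leq \lambda\,(d(x,Tx)+d(y,Ty)+d(z,Tz))$$ holds for all three pairwise distinct points $x,y,z\in X$. *)

(* Defs.v *)
From mathcomp Require Import all_boot all_order all_algebra.
From mathcomp Require Import all_classical all_reals all_analysis.

Set Implicit Arguments.
Unset Strict Implicit.
Unset Printing Implicit Defensive.

Import Order.TTheory GRing.Theory Num.Theory.
Import numFieldNormedType.Exports.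

Local Open Scope classical_set_scope.
Local Open Scope ring_scope.

Definition generalized_kannan (R : realType) (X : metricType R) (T : X -> X)
    : Prop :=
  exists lambda : R, 0 <= lambda < 2 / 3 /\
    forall x y z : X, x <> y -> y <> z -> x <> z ->
      mdist (T x) (T y) + mdist (T y) (T z) + mdist (T x) (T z)
        <= lambda * (mdist x (T x) + mdist y (T y) + mdist z (T z)).

(* Main.v *)
Require Import Defs.
From mathcomp Require Import all_boot all_order all_algebra.
From mathcomp Require Import all_classical all_reals all_analysis.
From mathcomp Require Import lra.

(** Let [p] be a fixed point.  In the generalized Kannan inequality for [p],
    [x], [z], the point [p] contributes no displacement, and the displacements
    of [x] and [z] are at most [d(p,x) + d(p,Tx)] and [d(p,z) + d(p,Tz)].
    Since [lambda < 2/3], the terms [d(p,Tx)] and [d(p,Tz)] can be absorbed on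
    the left, which leaves
    [d(p,Tx) + d(p,Tz) <= 2 (d(p,x) + d(p,z))] ([kannan_fixed_point_bound]).

    The auxiliary point [z] is free, so it can be taken as close to [p] as one
    likes when [p] is not isolated; with [d(p,z) < d(p,x)] the bound becomes
    [d(p,Tx) <= 4 d(p,x)], and continuity at [p] follows.  When [p] is
    isolated there is no such [z], but every map is continuous at [p]. *)

Set Implicit Arguments.
Unset Strict Implicit.
Unset Printing Implicit Defensive.

Import Order.TTheory GRing.Theory Num.Theory.
Import numFieldNormedType.Exports.

Local Open Scope classical_set_scope.
Local Open Scope card_scope.
Local Open Scope ring_scope.

(** The constant 2 comes from [lambda / (1 - lambda) < 2], which is
    equivalent to [lambda < 2/3]. *)
Lemma kannan_fixed_point_bound (R : realType) (X : metricType R) (T : X -> X)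
    (p x z : X) :
  generalized_kannan T -> T p = p -> p <> x -> x <> z -> p <> z ->
  mdist p (T x) + mdist p (T z) <= 2 * (mdist p x + mdist p z).
Proof.
move=> [lambda [/andP[lambda_ge0 lambda_lt] kannanT]] Tp px xz pz.
have := kannanT p x z px xz pz; rewrite Tp mdistxx add0r.
have displacement y : mdist y (T y) <= mdist p y + mdist p (T y).
  by rewrite (metric_sym p y); exact: metric_triangle.
set s := mdist x (T x) + mdist z (T z).
have s_ge0 : 0 <= s by rewrite addr_ge0// mdist_ge0.
have lambda_s : lambda * s <= 2 / 3 * s by rewrite ler_wpM2r// ltW.
have := displacement x; have := displacement z.
have := mdist_ge0 (T x) (T z); move: lambda_s; rewrite /s; lra.
Qed.

Lemma continuous_at_isolated (R : realType) (X : metricType R) (T : X -> X)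
    (p : X) (r : R) :
  0 < r -> (forall z, mdist p z < r -> z = p) -> {for p, continuous T}.
Proof.
move=> r_gt0 isolated A /nbhs_singleton ATp.
apply/nbhs_ballP; exists r => //= x; rewrite ballEmdist /= => /isolated ->.
exact: ATp.
Qed.

(** The radius at which the accumulation hypothesis is used depends on [x]: it
    is [d(p,x)] itself, so that the auxiliary point costs at most as much as
    [x] does and is automatically different from [x]. *)
Lemma kannan_fixed_point_lipschitz (R : realType) (X : metricType R)
    (T : X -> X) (p : X) :
  generalized_kannan T -> T p = p ->
  (forall r : R, 0 < r -> exists2 z, p <> z & mdist p z < r) ->
  forall x, mdist p (T x) <= 4 * mdist p x.
Proof.
move=> kannanT Tp accumulation x.
have [<-|/eqP px] := eqVneq p x; first by rewrite Tp mdistxx mulr0.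
have px_gt0 : 0 < mdist p x by rewrite mdist_gt0; exact/eqP.
have [z pz zx] := accumulation _ px_gt0.
have xz : x <> z by move=> xz; rewrite xz ltxx in zx.
have := kannan_fixed_point_bound kannanT Tp px xz pz.
have := mdist_ge0 p (T z); lra.
Qed.

Theorem proposition3p7 (R : realType) (X : metricType R)
    (hX : [set: 'I_3] #<= [set: X])
    (T : X -> X) (hT : generalized_kannan T) :
  forall p : X, T p = p -> {for p, continuous T}.
Proof.
move=> p Tp.
have [[r r_gt0 isolated]|not_isolated] :=
    pselect (exists2 r : R, 0 < r & forall z, mdist p z < r -> z = p).
  exact: continuous_at_isolated r_gt0 isolated.
have accumulation r : 0 < r -> exists2 z, p <> z & mdist p z < r.
  move=> r_gt0; apply: contrapT => noz; apply: not_isolated.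
  exists r => // z zr; apply: contrapT => zp; apply: noz.
  by exists z => // /esym.
apply/cvg_ballP => e e_gt0; apply/nbhs_ballP.
exists (e / 4) => /=; first by rewrite divr_gt0.
move=> x; rewrite /= Tp !ballEmdist /= => xe.
have := kannan_fixed_point_lipschitz hT Tp accumulation x; lra.
Qed.
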